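(* Let $F$ be a finite field with $|F|=q$ and $\operatorname{char}F=p>2$, and let $G_{can}$ be the infinite-dimensional unitary Grassmann algebra $G$ over $F$ with the $\mathbb{Z}_2$-grading induced by the automorphism $\phi_0$ given by $e_i\mapsto -e_i$ for all $i\geq 1$. Then $T_2(G_{can})=I_1$, where $I_1$ is the $T_2$-ideal of $F\langle X\rangle$ generated by the polynomials $$[y_1,y_2],\qquad [y_1,z_2],\qquad z_1z_2+z_2z_1,\qquad y_1^{pq}-y_1^{p}.$$
   Context: $G$ is the unitary Grassmann algebra over $F$ generated by $e_1,e_2,\ldots$ subject to $e_ie_j=-e_je_i$ for all $i,j$; it has $F$-basis consisting of $1$ and the products $e_{i_1}\cdots e_{i_n}$ with $i_1<\cdots<i_n$. An automorphism $\phi$ of $G$ of order two induces the $\mathbb{Z}_2$-grading $G=G_0\oplus G_1$ with $G_0=\{2^{-1}(a+\phi(a)) : a\in G\}$ (even component) and $G_1=\{2^{-1}(a-\phi(a)) : a\in G\}$ (odd component). $F\langle X\rangle$ is the free unitary associative algebra on $X=Y\cup Z$, $Y=\{y_1,y_2,\ldots\}$, $Z=\{z_1,z_2,\ldots\}$ (disjoint countable sets), $\mathbb{Z}_2$-graded by giving each $y_i$ degree $0$ and each $z_i$ degree $1$. For a $\mathbb{Z}_2$-graded algebra $A=A_0\oplus A_1$, $T_2(A)$ is the set of $\mathbb{Z}_2$-graded polynomial identities of $A$: the polynomials in $F\langle X\rangle$ that vanish under all substitutions of elements of $A_0$ for the $y$'s and of $A_1$ for the $z$'s. A $T_2$-ideal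 is a (two-sided) ideal of $F\langle X\rangle$ stable under all endomorphisms $\phi$ of $F\langle X\rangle$ with $\phi(F\langle X\rangle_i)\subset F\langle X\rangle_i$, $i=0,1$; the $T_2$-ideal generated by a set $S$ is the intersection of all $T_2$-ideals containing $S$. $[a,b]=ab-ba$. *)

(* Defs.v *)
From HB Require Import structures.
From mathcomp Require Import all_boot all_order all_algebra finmap.
From mathcomp.multinomials Require Import monalg.

Set Implicit Arguments.
Unset Strict Implicit.
Unset Printing Implicit Defensive.

Import GRing.Theory.

Local Open Scope fset_scope.
Local Open Scope ring_scope.

(* The Grassmann algebra on e_0, e_1, ...: the free module on the finite sets *)
(* of indices, where A = {i_1 < ... < i_n} stands for e_{i_1} ... e_{i_n}     *)
(* (see [gmonE]). Reordering e_A e_B costs one sign for each pair i in A,     *)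
(* j in B with j < i, and the product is 0 if A and B meet.                   *)

Definition ginv (A B : {fset nat}) : nat :=
  (\sum_(i <- A) \sum_(j <- B) (j < i))%N.

Definition gsgn (R : nzRingType) (A B : {fset nat}) : R :=
  if [disjoint A & B]%fset then (-1) ^+ ginv A B else 0.

Definition grassmann (R : comNzRingType) : Type := {malg R[{fset nat}]}.

Section Grassmann.
Context (R : comNzRingType).

Local Notation G := (grassmann R).
Local Notation sg := (gsgn R).

HB.instance Definition _ := GRing.Lmodule.copy G {malg R[{fset nat}]}.

Implicit Types (x y z : G) (A B C : {fset nat}).

Definition gone : G := << fset0 >>.

Definition gmul x y : G :=
  \sum_(A <- msupp x) \sum_(B <- msupp y)
    << x@_A * y@_B * sg A B *g A `|` B >>.

Lemma ginv0l B : ginv fset0 B = 0%N.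
Proof. by rewrite /ginv big_seq_fset0. Qed.

Lemma ginv0r A : ginv A fset0 = 0%N.
Proof. by rewrite /ginv big1 // => i _; rewrite big_seq_fset0. Qed.

Lemma big_fsetU_disj (f : nat -> nat) A B : [disjoint A & B]%fset ->
  (\sum_(i <- A `|` B) f i = \sum_(i <- A) f i + \sum_(i <- B) f i)%N.
Proof.
move=> dAB; rewrite (big_fsetID _ (mem A)) /=; congr addn.
  by apply: eq_fbigl => i; rewrite !inE /= andb_orl andbb [_ && (i \in A)]andbC
     orbC; case: (i \in A); rewrite ?orbT.
apply: eq_fbigl => i; rewrite !inE /=.
by have [/(fdisjointP dAB)/negPf->|] := boolP (i \in A); rewrite ?andbT ?andbF.
Qed.

Lemma ginvUl A B C : [disjoint A & B]%fset ->
  ginv (A `|` B) C = (ginv A C + ginv B C)%N.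
Proof. exact: big_fsetU_disj. Qed.

Lemma ginvUr A B C : [disjoint B & C]%fset ->
  ginv A (B `|` C) = (ginv A B + ginv A C)%N.
Proof.
by move=> dBC; rewrite /ginv -big_split /=; apply: eq_bigr => i _;
   rewrite big_fsetU_disj.
Qed.

Lemma gsgnA A B C : sg A B * sg (A `|` B) C = sg B C * sg A (B `|` C).
Proof.
rewrite /gsgn fdisjointUX fdisjointXU.
have [dAB|_] := boolP [disjoint A & B]%fset; last by rewrite mul0r mulr0.
have [dBC|_] := boolP [disjoint B & C]%fset; last by rewrite mul0r andbF mulr0.
rewrite andbT /=; case: ifP => dAC; rewrite ?mulr0 //.
by rewrite -!exprD ginvUl // ginvUr // addnA addnC.
Qed.

Lemma gmulEw (dx dy : {fset {fset nat}}) x y :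
  msupp x `<=` dx -> msupp y `<=` dy ->
  gmul x y = \sum_(A <- dx) \sum_(B <- dy)
    << x@_A * y@_B * sg A B *g A `|` B >>.
Proof.
move=> lex ley; rewrite /gmul (big_fset_incl _ lex) /=.
  apply/eq_bigr=> k1 _; apply/big_fset_incl => // k _ /mcoeff_outdom ->.
  by rewrite mulr0 mul0r monalgU0.
move=> k _ /mcoeff_outdom g1k.
by rewrite big1 => // k' _; rewrite g1k !mul0r monalgU0.
Qed.

Lemma gmul0x : left_zero 0 gmul.
Proof. by move=> x; rewrite /gmul msupp0 big_seq_fset0. Qed.

Lemma gmulx0 : right_zero 0 gmul.
Proof. by move=> x; rewrite /gmul big1 // => A _; rewrite msupp0 big_seq_fset0. Qed.

Lemma gmulUU a b A B :
  gmul << a *g A >> << b *g B >> = << a * b * sg A B *g A `|` B >>.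
Proof. by rewrite (gmulEw msuppU_le msuppU_le) !big_seq_fset1 !mcoeffUU. Qed.

Lemma gmulEl x y : gmul x y = \sum_(A <- msupp x) gmul << x@_A *g A >> y.
Proof.
apply/eq_bigr => A _; rewrite (gmulEw msuppU_le (fsubset_refl _)) big_seq_fset1.
by rewrite mcoeffUU.
Qed.

Lemma gmulEr x y : gmul x y = \sum_(B <- msupp y) gmul x << y@_B *g B >>.
Proof.
rewrite [LHS]/gmul exchange_big; apply/eq_bigr => B _.
rewrite (gmulEw (fsubset_refl _) msuppU_le); apply/eq_bigr => A _.
by rewrite big_seq_fset1 mcoeffUU.
Qed.

Lemma gmulDl : left_distributive gmul +%R.
Proof.
move=> x y z; set d := msupp x `|` msupp y.
rewrite (@gmulEw d (msupp z)) ?msuppD_le // (@gmulEw d (msupp z) x) ?fsubsetUl //.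
rewrite (@gmulEw d (msupp z) y) ?fsubsetUr // -big_split /=.
apply/eq_bigr => A _; rewrite -big_split /=; apply/eq_bigr => B _.
by rewrite mcoeffD !mulrDl monalgUD.
Qed.

Lemma gmulDr : right_distributive gmul +%R.
Proof.
move=> z x y; set d := msupp x `|` msupp y.
rewrite (@gmulEw (msupp z) d) ?msuppD_le // (@gmulEw (msupp z) d z x) ?fsubsetUl //.
rewrite (@gmulEw (msupp z) d z y) ?fsubsetUr // -big_split /=.
apply/eq_bigr => A _; rewrite -big_split /=; apply/eq_bigr => B _.
by rewrite mcoeffD mulrDr mulrDl monalgUD.
Qed.

Lemma gmul1x : left_id gone gmul.
Proof.
move=> x; rewrite gmulEr [RHS]monalgE; apply/eq_bigr => A _.
by rewrite gmulUU /gsgn fdisjoint0X ginv0l mulr1 mul1r fset0U.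
Qed.

Lemma gmulx1 : right_id gone gmul.
Proof.
move=> x; rewrite gmulEl [RHS]monalgE; apply/eq_bigr => A _.
by rewrite gmulUU /gsgn fdisjointX0 ginv0r !mulr1 fsetU0.
Qed.

Lemma gmulA : associative gmul.
Proof.
move=> x y z.
rewrite [RHS](big_morph (gmul^~ _) (fun _ _ => gmulDl _ _ _) (gmul0x _)).
rewrite gmulEl; apply/eq_bigr=> A _.
rewrite [LHS](big_morph (gmul _) (fun _ _ => gmulDr _ _ _) (gmulx0 _)).
rewrite [RHS](big_morph (gmul^~ _) (fun _ _ => gmulDl _ _ _) (gmul0x _)).
apply/eq_bigr=> B _.
rewrite [LHS](big_morph (gmul _) (fun _ _ => gmulDr _ _ _) (gmulx0 _)).
rewrite gmulEr; apply/eq_bigr=> C _; rewrite !gmulUU fsetUA; congr << _ *g _ >>.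
by rewrite -!mulrA; congr (_ * (_ * _)); rewrite -gsgnA mulrCA.
Qed.

Lemma gone_neq0 : gone != 0 :> G.
Proof. by apply/eqP/malgP=> /(_ fset0) /eqP; rewrite !mcoeffsE oner_eq0. Qed.

HB.instance Definition _ := GRing.Zmodule_isNzRing.Build G
  gmulA gmul1x gmulx1 gmulDl gmulDr gone_neq0.

Lemma gscaleU a b A : a *: (<< b *g A >> : G) = << a * b *g A >>.
Proof. by apply/malgP => B; rewrite mcoeffZ !mcoeffU mulrnAr. Qed.

Lemma gmul_def x y : x * y = gmul x y. Proof. by []. Qed.

Lemma gscaleAl a x y : a *: (x * y) = (a *: x) * y.
Proof.
rewrite !gmul_def (gmulEw (msuppZ_le a x) (fsubset_refl _)) scaler_sumr.
apply: eq_bigr => A _; rewrite scaler_sumr; apply: eq_bigr => B _.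
by rewrite gscaleU mcoeffZ !mulrA.
Qed.

HB.instance Definition _ := GRing.Lmodule_isLalgebra.Build R G gscaleAl.

Lemma gscaleAr a x y : a *: (x * y) = x * (a *: y).
Proof.
rewrite !gmul_def (gmulEw (fsubset_refl _) (msuppZ_le a y)) scaler_sumr.
apply: eq_bigr => A _; rewrite scaler_sumr; apply: eq_bigr => B _.
by rewrite gscaleU mcoeffZ [x@_A * (a * _)]mulrCA !mulrA.
Qed.

HB.instance Definition _ := GRing.Lalgebra_isAlgebra.Build R G gscaleAr.

Definition ggen (i : nat) : G := << [fset i] >>.

Lemma ggen_anticomm i j : ggen i * ggen j = - (ggen j * ggen i).
Proof.
rewrite !gmul_def !gmulUU !mul1r -monalgUN fsetUC; congr << _ *g _ >>.
rewrite /gsgn !fdisjointX1 !inE eq_sym /ginv !big_seq_fset1.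
by case: ltngtP => //=; rewrite ?oppr0 // expr0 expr1 opprK.
Qed.

Lemma gmonE A : (<< A >> : G) = \prod_(i <- sort leq A) ggen i.
Proof.
have [n] := ubnP #|` A|; elim: n => // n IHn in A *; rewrite ltnS => leAn.
case Es: (sort leq A) => [|a s].
  rewrite big_nil (_ : A = fset0) //; apply/fsetP => i.
  by rewrite -(mem_sort leq) Es inE.
have: sorted leq (a :: s) by rewrite -Es; apply/sort_sorted/leq_total.
have: uniq (a :: s) by rewrite -Es sort_uniq fset_uniq.
have memA i : (i \in A) = (i \in a :: s) by rewrite -Es mem_sort.
rewrite /= => /andP[anins uniqs] /[dup] /path_sorted sorteds.
rewrite (path_sortedE leq_trans) => /andP[/allP lea _].
have Ds : sort leq (A `\ a) = s.
  apply: (sorted_eq leq_trans anti_leq) => //; first exact/sort_sorted/leq_total.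
  apply: uniq_perm => //; first by rewrite sort_uniq fset_uniq.
  move=> i; rewrite mem_sort in_fsetD1 memA inE.
  by case: eqP => [->|//]; rewrite (negPf anins).
have aA : a \in A by rewrite memA mem_head.
rewrite big_cons -[in \prod_(i <- s) _]Ds -IHn; last first.
  by rewrite (cardfsD1 a) aA in leAn.
rewrite gmul_def gmulUU fsetD1K // !mul1r /gsgn fdisjoint1X in_fsetD1 eqxx /=.
rewrite /ginv big_seq_fset1 big_seq big1 // => i.
rewrite in_fsetD1 memA inE => /andP[/negPf->] /= /lea.
by case: ltnP.
Qed.

(* The automorphism e_i |-> - e_i acts on e_A as (-1)^|A|.                    *)

Definition phi0 x : G := [malg A in msupp x => (-1) ^+ #|` A| * x@_A].

Lemma phi0_coeff x A : (phi0 x)@_A = (-1) ^+ #|` A| * x@_A.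
Proof.
rewrite /phi0 mcoeffE; case: ifP => // /negbT /mcoeff_outdom ->.
by rewrite mulr0.
Qed.

Lemma phi0_is_linear : linear phi0.
Proof.
move=> a x y; apply/malgP => A.
by rewrite phi0_coeff !(mcoeffD, mcoeffZ) !phi0_coeff mulrDr mulrCA.
Qed.

HB.instance Definition _ := GRing.isLinear.Build R G G _ phi0 phi0_is_linear.

Lemma phi0U a A : phi0 << a *g A >> = << (-1) ^+ #|` A| * a *g A >>.
Proof.
apply/malgP => B; rewrite phi0_coeff !mcoeffU.
by case: eqP => [->|]; rewrite ?mulr1n // !mulr0n mulr0.
Qed.

Lemma phi0_is_monoid_morphism : monoid_morphism phi0.
Proof.
split=> [|x y]; first by rewrite phi0U cardfs0 mulr1.
have phi0E z : phi0 z = \sum_(A <- msupp z) << (-1) ^+ #|` A| * z@_A *g A >>.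
  by rewrite {1}[z]monalgE raddf_sum; apply: eq_bigr => A _; exact: phi0U.
rewrite gmul_def raddf_sum (phi0E x) mulr_suml; apply: eq_bigr => A _.
rewrite raddf_sum (phi0E y) mulr_sumr; apply: eq_bigr => B _.
rewrite [LHS]phi0U gmul_def gmulUU; congr << _ *g _ >>.
rewrite /gsgn; case: ifP => [dAB|_]; last by rewrite !mulr0.
rewrite cardfsU (disjoint_fsetI0 dAB) cardfs0 subn0 exprD !mulrA.
by congr (_ * _ * _); rewrite mulrAC.
Qed.

HB.instance Definition _ :=
  GRing.isMonoidMorphism.Build G G phi0 phi0_is_monoid_morphism.

Lemma phi0_gen i : phi0 (ggen i) = - ggen i.
Proof. by rewrite phi0U cardfs1 mulr1 expr1 monalgUN. Qed.

Lemma phi0K : involutive phi0.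
Proof.
by move=> x; apply/malgP => A; rewrite !phi0_coeff mulrA -expr2 sqrr_sign mul1r.
Qed.

End Grassmann.

Definition even_part (F : fieldType) (A : algType F) (phi : A -> A) (x : A) :=
  exists a, x = 2^-1 *: (a + phi a).

Definition odd_part (F : fieldType) (A : algType F) (phi : A -> A) (x : A) :=
  exists a, x = 2^-1 *: (a - phi a).

(* The variables are indexed from 0: [inl i] is y_{i+1}, [inr i] is z_{i+1}.  *)
Notation freealg F := {malg F[{fmonom (nat + nat)%type}]}.

Section GradedIdentities.
Context (F : fieldType).

Implicit Types (f g : freealg F) (P I S : freealg F -> Prop).

Definition yvar (i : nat) : freealg F := << fmu (inl i) >>.
Definition zvar (i : nat) : freealg F := << fmu (inr i) >>.

Definition is_z (x : nat + nat) : bool := if x is inr _ then true else false.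

Definition free_homog (d : bool) f :=
  forall m, m \in msupp f -> odd (count is_z m) = d.

Definition geval (A : algType F) (s : nat + nat -> A) : freealg F -> A :=
  mmap (in_alg A) (fun m : {fmonom (nat + nat)%type} => \prod_(x <- m) s x).

Definition T2 (A : algType F) (A0 A1 : A -> Prop) f :=
  forall s : nat + nat -> A,
    (forall i, A0 (s (inl i))) -> (forall i, A1 (s (inr i))) -> geval s f = 0.

Definition two_sided_ideal I :=
  [/\ I 0, forall f g, I f -> I g -> I (f + g)
    & forall f g, I f -> I (g * f) /\ I (f * g)].

Definition graded_endo (phi : {lrmorphism freealg F -> freealg F}) :=
  forall d f, free_homog d f -> free_homog d (phi f).

Definition T2_ideal I :=
  two_sided_ideal I /\ forall phi, graded_endo phi -> forall f, I f -> I (phi f).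

Definition T2_generated S f :=
  forall I, T2_ideal I -> (forall g, S g -> I g) -> I f.

Definition lie f g := f * g - g * f.

Definition I1_gens (p q : nat) f :=
  [\/ f = lie (yvar 0) (yvar 1),
      f = lie (yvar 0) (zvar 1),
      f = zvar 0 * zvar 1 + zvar 1 * zvar 0
    | f = yvar 0 ^+ (p * q) - yvar 0 ^+ p].

Definition I1 (p q : nat) := T2_generated (I1_gens p q).

End GradedIdentities.

(* Main.v *)
From HB Require Import structures.
Require Import Defs.
From mathcomp Require Import all_boot all_order all_algebra finfield finmap.
From mathcomp.multinomials Require Import monalg.

(** Modulo the four kinds of generators every polynomial is a combination of
    normal words

      y_0 ^ a_0 z_0 ^ e_0 ... y_(n-1) ^ a_(n-1) z_(n-1) ^ e_(n-1),

    with a_i < pq and e_i in {0, 1}: letters commute up to a scalar, z^2 = 0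
    follows from z z' + z' z = 0 because 2 is invertible, and y^(pq) can be
    replaced by y^p ([nreducible_word], [I1_nreducible]). The generators are
    identities of the Grassmann algebra: it is supercommutative
    ([ghomogM_comm]), and an even element with scalar part c has p-th power
    c^p ([even_exp_pchar]), which the Frobenius map x |-> x^q of F fixes
    ([I1_sub_T2_Grassmann]). So the theorem amounts to the linear independence
    of the normal words as functions on the Grassmann algebra
    ([nword_independent]).

    For independence, give y_i the value c + w_1 + ... + w_r, where c is in F,
    r < p, and the w_k are products of two generators; the generators used
    for different i are different. The w_k commute and square to 0, so
    P(c + w_1 + ... + w_r) has at w_1 ... w_r the coefficient P^(r)(c), the
    r-th derivative of P at c ([mcoeff_gpairsX]). Give z_i either a fresh
    generator or 0. The generators used for y_i and z_i lie in the i-th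
    interval of indices, so the coefficient of the product of all generators
    used is the product over i of such numbers, without any sign
    ([mcoeff_prod_block], [mcoeff_probe]).

    This leaves a question on polynomials in one variable. The numbers
    P^(r)(c), for r < p and c in F, determine P among the polynomials of
    degree less than pq: if they all vanish, Taylor expansion shows that
    (X - c)^p divides P for each of the q points c, so P = 0
    ([hermite_eq0]). Hence there is a dual basis ([hermite_dual_basis]), and
    the n-fold products of its elements isolate each single coefficient of a
    combination of normal words ([tensor_dual_basis]). *)

Set Implicit Arguments.
Unset Strict Implicit.
Unset Printing Implicit Defensive.

Import GRing.Theory.

(** * Hermite interpolation at all points of a finite field *)

Section HermiteInterpolation.
Local Open Scope ring_scope.

Lemma fact_pchar_neq0 (R : idomainType) (p r : nat) :
  p \in [pchar R] -> (r < p)%N -> r`!%:R != 0 :> R.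
Proof.
move=> pcharRp; elim: r => [|r IHr] ltrp; first by rewrite oner_neq0.
rewrite factS natrM mulf_neq0 ?IHr ?(ltnW ltrp) //.
by rewrite -(dvdn_pcharf pcharRp) gtnNdvd.
Qed.

(** By Taylor expansion at x: the terms of order at least p are divisible by
    (X - x)^p, and those of order i < p vanish, since i! is invertible. *)
Lemma dvdp_XsubC_exp (F : fieldType) (p : nat) (x : F) (P : {poly F}) :
    p \in [pchar F] -> (forall r, (r < p)%N -> P^`(r).[x] = 0) ->
  ('X - x%:P) ^+ p %| P.
Proof.
(* P is its own value at X = x + (X - x), computed over the ring {poly F}. *)
move=> pcharFp dP0; have ->: P = (P^:P).[x%:P + ('X - x%:P)].
  by rewrite addrC subrK -[LHS]comp_polyXr.
rewrite nderiv_taylor; last exact: mulrC.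
apply: (big_ind (fun Q => ('X - x%:P) ^+ p %| Q)) => [||i _].
- exact: dvdp0.
- by move=> Q R; apply: dvdp_add.
have [ltip|leip] := ltnP i p; last by rewrite dvdp_mull ?dvdp_exp2l.
have: (P^`N(i)).[x] *+ i`! = 0 by rewrite -hornerMn -nderivn_def dP0.
move/eqP; rewrite -mulr_natr mulf_eq0 (negPf (fact_pchar_neq0 pcharFp ltip)).
rewrite orbF => /eqP Pi0.
by rewrite nderivn_map horner_map Pi0 rmorph0 mul0r dvdp0.
Qed.

Lemma dvdp_prod_XsubC_exp (F : fieldType) (p : nat) (s : seq F) (P : {poly F}) :
    uniq s -> (forall x, x \in s -> ('X - x%:P) ^+ p %| P) ->
  \prod_(x <- s) ('X - x%:P) ^+ p %| P.
Proof.
elim: s => [|x s IHs] /=; first by rewrite big_nil dvd1p.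
case/andP=> xs uniqs dvP; rewrite big_cons Gauss_dvdp.
  by rewrite dvP ?mem_head //= IHs // => y ys; rewrite dvP // inE ys orbT.
rewrite coprimep_expl // coprimep_sym coprimep_XsubC prodrXl.
by rewrite rootE horner_exp expf_eq0 -rootE root_prod_XsubC (negPf xs) andbF.
Qed.

Lemma hermite_eq0 (F : finFieldType) (p : nat) (P : {poly F}) :
    p \in [pchar F] -> (size P <= p * #|F|)%N ->
    (forall x r, (r < p)%N -> P^`(r).[x] = 0) ->
  P = 0.
Proof.
move=> pcharFp leP dP0; apply/eqP/contraT => P0.
have /(dvdp_leq P0): \prod_(x <- enum F) ('X - x%:P) ^+ p %| P.
  apply: dvdp_prod_XsubC_exp => [|x _]; first exact: enum_uniq.
  by apply: dvdp_XsubC_exp => // r; apply: dP0.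
(* The product has degree pq, too large for a divisor of P. *)
rewrite prodrXl leqNgt => /negP[]; apply: (leq_ltn_trans leP).
rewrite polySpred ?expf_neq0 ?monic_neq0 ?monic_prod_XsubC // ltnS.
by rewrite size_exp size_prod_XsubC -cardE mulnC.
Qed.

(** The values of the derivatives of X^a form a matrix whose rows are independent
    by [hermite_eq0]; D is a right inverse of it. *)
Lemma hermite_dual_basis (F : finFieldType) (p : nat) :
    p \in [pchar F] ->
  exists D : 'I_p * F -> 'I_(p * #|F|) -> F, forall a b : 'I_(p * #|F|),
    \sum_(t : 'I_p * F) (a ^_ t.1)%:R * t.2 ^+ (a - t.1) * D t b = (a == b)%:R.
Proof.
move=> pcharFp; set m := (p * #|F|)%N; pose T : finType := ('I_p * F)%type.
(* The columns of a matrix are ordinals, so the pairs (r, c) are enumerated. *)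
pose pt (j : 'I_#|T|) : 'I_p * F := @enum_val T T j.
pose M : 'M[F]_(m, #|T|) := \matrix_(a, j) ('X^a)^`((pt j).1).[(pt j).2].
have /row_freeP[B MB]: row_free M.
  apply: inj_row_free => v /rowP vM.
  pose P := \sum_(a < m) v ord0 a *: 'X^a.
  have coefP (a : 'I_m) : P`_a = v ord0 a.
    rewrite /P coef_sum (bigD1 a) //= coefZ coefXn eqxx mulr1 big1 ?addr0 // => b ba.
    by rewrite coefZ coefXn eq_sym (negPf ba : (b == a :> nat) = false) mulr0.
  have P0: P = 0.
    apply: (hermite_eq0 pcharFp) => [|x r ltrp].
      apply/leq_sizeP => i lei; rewrite /P coef_sum big1 // => a _.
      by rewrite coefZ coefXn gtn_eqF ?mulr0 // (leq_trans (ltn_ord a)).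
    have := vM (enum_rank ((Ordinal ltrp, x) : T)); rewrite !mxE => <-.
    rewrite /P linear_sum horner_sum; apply: eq_bigr => a _.
    by rewrite linearZ hornerZ mxE /pt enum_rankK.
  by apply/rowP => a; rewrite mxE -coefP P0 coef0.
exists (fun t b => B (enum_rank (t : T)) b) => a b.
have /matrixP/(_ a b) := MB; rewrite !mxE => <-.
rewrite (reindex pt) /=; last first.
  by exists (fun t => enum_rank (t : T)) => ? _; rewrite /pt ?enum_valK ?enum_rankK.
apply: eq_bigr => j _; rewrite mxE enum_valK derivnXn hornerMn hornerXn.
by rewrite -[in RHS]mulr_natl.
Qed.

End HermiteInterpolation.

(** * Tensor powers of a dual basis *)

Section TensorIndependence.
Local Open Scope ring_scope.

(** If D is dual to K on one factor, the products of the D (t i) (v i) are dual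
    to the products of the K (u i) (t i), by distributivity. *)
Lemma tensor_dual_basis (F : comNzRingType) (I U T : finType)
    (K : U -> T -> F) (D : T -> U -> F) (c : {ffun I -> U} -> F) :
    (forall a b, \sum_t K a t * D t b = (a == b)%:R) ->
    (forall t : {ffun I -> T}, \sum_u c u * \prod_i K (u i) (t i) = 0) ->
  forall v, c v = 0.
Proof.
move=> KD c0 v; have ->: c v = \sum_u c u * \prod_i (u i == v i)%:R.
  rewrite (bigD1 v) //= big1 ?mulr1 => [|i _]; last by rewrite eqxx.
  rewrite big1 ?addr0 // => u neq_uv; have [i neq_i] : exists i, u i != v i.
    apply/existsP; apply: contraR neq_uv; rewrite negb_exists => /forallP eq_uv.
    by apply/eqP/ffunP => i; apply/eqP; move: (eq_uv i); rewrite negbK.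
  by rewrite (bigD1 i) //= (negPf neq_i) mul0r mulr0.
(* Expand each Kronecker symbol by duality, then sum over u first. *)
under eq_bigr do under eq_bigr do rewrite -KD.
under eq_bigr do rewrite bigA_distr_bigA mulr_sumr.
rewrite exchange_big big1 //= => t _.
under eq_bigr do rewrite big_split mulrA.
by rewrite -mulr_suml c0 mul0r.
Qed.

End TensorIndependence.

(** * Signs, parities and p-th powers in the Grassmann algebra *)

Section RingPowers.
Local Open Scope ring_scope.

Lemma exprD_pchar_comm (R : nzRingType) p (x y : R) :
  p \in [pchar R] -> GRing.comm x y -> (x + y) ^+ p = x ^+ p + y ^+ p.
Proof.
by move=> pcharRp cxy; rewrite -!(pFrobenius_autE pcharRp) pFrobenius_autD_comm.
Qed.

(** First-order Taylor expansion of X^a, exact since w * w = 0. *)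
Lemma exprD_sqr0 (R : nzRingType) (x w : R) a :
  GRing.comm x w -> w * w = 0 -> (x + w) ^+ a = x ^+ a + (x ^+ a.-1 * w) *+ a.
Proof.
move=> cxw ww0; elim: a => [|[|a] IHa]; first by rewrite mulr0n addr0.
  by rewrite !expr1 mul1r.
rewrite exprSr IHa mulrDr !mulrDl -!exprSr -addrA; congr (_ + _).
rewrite !mulrnAl -!mulrA ww0 mulr0 mul0rn addr0 -cxw mulrA -exprSr.
by rewrite mulrS addrC -mulrS addrC -mulrSr.
Qed.

End RingPowers.

Section GrassmannSupport.
Local Open Scope fset_scope.
Local Open Scope ring_scope.
Variable F : fieldType.
Local Notation G := (grassmann F).
Implicit Types (x y z : G) (A B C : {fset nat}) (Q : {fset nat} -> Prop).

(** Parity and being supported on a given set of generators are both conditions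
    on the basis monomials that occur; their closure properties are shared here. *)
Definition gspan Q x := forall A, x@_A != 0 -> Q A.

Lemma gspan0 Q : gspan Q 0.
Proof. by move=> A; rewrite mcoeff0 eqxx. Qed.

Lemma gspanU Q (a : F) A : Q A -> gspan Q << a *g A >>.
Proof.
move=> QA B; rewrite mcoeffU; case: (A =P B) => [<- //|_].
by rewrite mulr0n eqxx.
Qed.

Lemma gspanD Q x y : gspan Q x -> gspan Q y -> gspan Q (x + y).
Proof.
move=> Qx Qy A; rewrite mcoeffD => xyA.
have [xA|/Qx //] := eqVneq x@_A 0.
by apply: Qy; rewrite xA add0r in xyA.
Qed.

Lemma gspanZ Q (a : F) x : gspan Q x -> gspan Q (a *: x).
Proof.
move=> Qx A; rewrite mcoeffZ => axA; apply: Qx.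
by apply: contraNneq axA => ->; rewrite mulr0.
Qed.

Lemma gspan_sum Q I (r : seq I) (P : pred I) (f : I -> G) :
  (forall i, P i -> gspan Q (f i)) -> gspan Q (\sum_(i <- r | P i) f i).
Proof.
by move=> Qf; apply: big_ind => //; [apply: gspan0|move=> ? ?; apply: gspanD].
Qed.

Lemma gspanM Q1 Q2 Q x y :
    (forall A B, [disjoint A & B] -> Q1 A -> Q2 B -> Q (A `|` B)) ->
  gspan Q1 x -> gspan Q2 y -> gspan Q (x * y).
Proof.
move=> QU Qx Qy; rewrite gmul_def /gmul big_seq.
apply: gspan_sum => A; rewrite -mcoeff_neq0 => /Qx QA.
rewrite big_seq; apply: gspan_sum => B; rewrite -mcoeff_neq0 => /Qy QB.
rewrite /gsgn; case: ifP => [dAB|_]; first by apply: gspanU; apply: QU.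
by rewrite mulr0 monalgU0; apply: gspan0.
Qed.

Lemma gmonalgE x : x = \sum_(A <- msupp x) (<< x@_A *g A >> : G).
Proof. exact: monalgE. Qed.

End GrassmannSupport.

Section GrassmannParity.
Local Open Scope fset_scope.
Local Open Scope ring_scope.
Variable F : fieldType.
Local Notation G := (grassmann F).
Implicit Types (x y z : G) (A B C : {fset nat}).

Definition ghomog (d : bool) := gspan (F := F) (fun A => odd #|` A| = d).

Hypothesis F2 : (2%:R : F) != 0.

(** Each pair (i, j) in A x B is an inversion in exactly one of the two orders. *)
Lemma ginvC A B : [disjoint A & B] -> (ginv A B + ginv B A = #|` A| * #|` B|)%N.
Proof.
move=> dAB; rewrite /ginv exchange_big -big_split /=.
rewrite mulnC card_fset_sum1 big_distrl /=.
rewrite big_seq [RHS]big_seq; apply: eq_bigr => j jB.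
rewrite mul1n -big_split card_fset_sum1 /= big_seq [RHS]big_seq.
apply: eq_bigr => i iA; case: ltngtP => // ij.
by move/fdisjointP/(_ i iA): dAB; rewrite -ij jB.
Qed.

Lemma gsgnC A B : gsgn F B A = (-1) ^+ (#|` A| * #|` B|) * gsgn F A B.
Proof.
rewrite /gsgn fdisjoint_sym; case: ifP => [dAB|_]; last by rewrite mulr0.
by rewrite -(ginvC dAB) addnC exprD -mulrA -expr2 sqrr_sign mulr1.
Qed.

(** The converse direction is where 2 != 0 is used: it separates the two
    eigenvalues of phi0. *)
Lemma ghomogP d x : ghomog d x <-> phi0 x = (-1) ^+ d *: x.
Proof.
split=> [hx|hx A xA].
  apply/malgP => A; rewrite phi0_coeff mcoeffZ -signr_odd.
  by have [->|/hx->//] := eqVneq x@_A 0; rewrite !mulr0.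
have /malgP/(_ A) := hx.
rewrite phi0_coeff mcoeffZ => /(mulIf xA).
rewrite -signr_odd; case: (odd _); case: d {hx} => //= /eqP;
  rewrite ?expr0 ?expr1; first rewrite eq_sym; by rewrite -addr_eq0 (negPf F2).
Qed.

Lemma ghomogM_comm d e x y : ghomog d x -> ghomog e y ->
  x * y = (-1) ^+ (d && e) *: (y * x).
Proof.
move=> hx hy; rewrite !gmul_def /gmul exchange_big scaler_sumr /=.
rewrite big_seq [RHS]big_seq; apply: eq_bigr => B; rewrite -mcoeff_neq0 => yB.
rewrite scaler_sumr big_seq [RHS]big_seq.
apply: eq_bigr => A; rewrite -mcoeff_neq0 => xA.
rewrite gscaleU (gsgnC A B) -[in RHS](signr_odd _ (_ * _)) oddM.
rewrite (hx _ xA) (hy _ yB) fsetUC.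
set s : F := (-1) ^+ _; have ss : s * s = 1 by rewrite -expr2 sqrr_sign.
by rewrite [s * _]mulrCA (mulrA s s) ss mul1r (mulrC y@_B).
Qed.

Lemma even_comm d x y : ghomog false x -> ghomog d y -> GRing.comm x y.
Proof. by move=> hx hy; have := ghomogM_comm hx hy; rewrite scale1r. Qed.

Lemma ghomogM d e x y : ghomog d x -> ghomog e y -> ghomog (d (+) e) (x * y).
Proof.
apply: gspanM => A B dAB oddA oddB.
by rewrite cardfsU (disjoint_fsetI0 dAB) cardfs0 subn0 oddD oddA oddB.
Qed.

Lemma even_partE x : even_part (@phi0 F) x <-> ghomog false x.
Proof.
rewrite ghomogP scale1r; split=> [[a ->]|hx].
  by rewrite linearZ /= raddfD /= phi0K addrC.
by exists x; rewrite hx -mulr2n -scaler_nat scalerA mulVf // scale1r.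
Qed.

Lemma odd_partE x : odd_part (@phi0 F) x <-> ghomog true x.
Proof.
rewrite ghomogP scaleN1r; split=> [[a ->]|hx].
  by rewrite linearZ /= raddfB /= phi0K -scalerN opprB.
by exists x; rewrite hx opprK -mulr2n -scaler_nat scalerA mulVf // scale1r.
Qed.

(** The p-th power is additive on the commutative even part, and a basis monomial
    other than 1 squares to 0. *)
Lemma even_exp_pchar p x : p \in [pchar F] -> ghomog false x ->
  x ^+ p = x@_fset0 ^+ p *: (1 : G).
Proof.
move=> pcharFp hx.
have pcharGp : p \in [pchar G] by rewrite pchar_lalg.
have pgt1 := prime_gt1 (pcharf_prime pcharFp).
have p_neq0 : (p == 0)%N = false by rewrite gtn_eqF // ltnW.
pose E z := z ^+ p = z@_fset0 ^+ p *: (1 : G) /\ ghomog false z.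
suff [] : E x by [].
rewrite [x]gmonalgE big_seq; apply: big_ind => [|y z [Ey hy] [Ez hz]|A].
- split; last exact: gspan0.
  by rewrite mcoeff0 !expr0n p_neq0 mulr0n scale0r.
- split; last exact: gspanD.
  have cyz : GRing.comm y z by apply: even_comm hy hz.
  rewrite (exprD_pchar_comm pcharGp cyz) Ey Ez mcoeffD.
  by rewrite (exprD_pchar_comm pcharFp (mulrC _ _)) scalerDl.
rewrite -mcoeff_neq0 => xA; split; last first.
  exact: gspanU (hx _ xA).
rewrite mcoeffU; case: eqP => [->|/eqP A0].
  rewrite mulr1n (_ : << _ *g fset0 >> = x@_fset0 *: (1 : G)); last first.
    by rewrite gscaleU mulr1.
  by rewrite exprZn expr1n.
rewrite mulr0n expr0n p_neq0 mulr0n scale0r.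
rewrite -(subnKC pgt1) exprD (_ : _ ^+ 2 = 0) ?mul0r // expr2 gmul_def gmulUU.
rewrite /gsgn -fsetI_eq0 fsetIid (negPf A0).
by rewrite mulr0 monalgU0.
Qed.

End GrassmannParity.

(** * Coefficients of products with separated supports *)

Section GrassmannCoefficients.
Local Open Scope fset_scope.
Local Open Scope ring_scope.
Variable F : fieldType.
Local Notation G := (grassmann F).
Implicit Types (x y z : G) (A B C : {fset nat}) (S T : pred nat).

Lemma gmulE (dx dy : {fset {fset nat}}) x y :
    msupp x `<=` dx -> msupp y `<=` dy ->
  x * y = \sum_(A <- dx) \sum_(B <- dy)
    (<< x@_A * y@_B * gsgn F A B *g A `|` B >> : G).
Proof. exact: gmulEw. Qed.

Definition gsupported S := gspan (F := F) (fun A => {subset A <= S}).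

Lemma gsupported_sub S T x :
  {subset S <= T} -> gsupported S x -> gsupported T x.
Proof. by move=> sST Sx A /Sx sAS i /sAS/sST. Qed.

Lemma gsupported1 S : gsupported S 1.
Proof. by apply: gspanU => i; rewrite in_fset0. Qed.

Lemma gsupportedM S x y : gsupported S x -> gsupported S y -> gsupported S (x * y).
Proof. by apply: gspanM => A B _ sA sB i /fsetUP[/sA|/sB]. Qed.

Lemma gsupportedX S x n : gsupported S x -> gsupported S (x ^+ n).
Proof.
move=> Sx; elim: n => [|n IHn]; first exact: gsupported1.
by rewrite exprS; apply: gsupportedM.
Qed.

Lemma gsgn_lt A B : (forall i j, i \in A -> j \in B -> (i < j)%N) ->
  gsgn F A B = 1.
Proof.
move=> ltAB; rewrite /gsgn; have ->: [disjoint A & B].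
  by apply/fdisjointP => i iA; apply/negP => /(ltAB _ _ iA); rewrite ltnn.
rewrite /ginv big_seq big1 // => i iA; rewrite big_seq big1 // => j jB.
by rewrite ltnNge ltnW ?ltAB.
Qed.

(** Separated index sets make the factors of a basis monomial unique, so that a
    single pair of terms contributes to a coefficient of a product. *)
Lemma fsetU_lt_inj S T A B A' B' :
    (forall i j, S i -> T j -> (i < j)%N) ->
    {subset A <= S} -> {subset B <= T} -> {subset A' <= S} -> {subset B' <= T} ->
  A' `|` B' = A `|` B -> A' = A /\ B' = B.
Proof.
move=> ltST sA sB sA' sB' /fsetP eqU.
have noST i : S i -> T i -> False by move=> Si /(ltST _ _ Si); rewrite ltnn.
split; apply/fsetP => i; have := eqU i; rewrite !inE;
  case iA': (i \in A'); case iA: (i \in A);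
  case iB': (i \in B'); case iB: (i \in B) => //= _;
  by case: (noST i); [exact: sA || exact: sA'|exact: sB || exact: sB'].
Qed.

(** As all generators in x precede those in y, no reordering sign appears. *)
Lemma mcoeffM_lt S T x y A B :
    (forall i j, S i -> T j -> (i < j)%N) ->
    gsupported S x -> gsupported T y -> {subset A <= S} -> {subset B <= T} ->
  (x * y)@_(A `|` B) = x@_A * y@_B.
Proof.
move=> ltST Sx Ty sA sB.
rewrite (@gmulE (A |` msupp x) (B |` msupp y)) ?fsubsetUr //.
have other A' B' : (A', B') != (A, B) ->
    (<< x@_A' * y@_B' * gsgn F A' B' *g A' `|` B' >> : G)@_(A `|` B) = 0.
  move=> neq; have [->|xA'] := eqVneq x@_A' 0.
    by rewrite !mul0r mcoeffU mul0rn.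
  have [->|yB'] := eqVneq y@_B' 0.
    by rewrite mulr0 mul0r mcoeffU mul0rn.
  rewrite mcoeffU; case: eqP => // eqU.
  have [eA eB] := fsetU_lt_inj ltST sA sB (Sx _ xA') (Ty _ yB') eqU.
  by rewrite eA eB eqxx in neq.
rewrite raddf_sum (big_fsetD1 A) ?fset1U1 //= raddf_sum (big_fsetD1 B) ?fset1U1 //=.
rewrite mcoeffUU gsgn_lt => [|i j /sA iS /sB jT]; last exact: ltST.
rewrite mulr1 big1_fset => [|B' + _]; last first.
  by rewrite in_fsetD1 => /andP[neqB _]; apply: other; rewrite xpair_eqE negb_and neqB
     orbT.
rewrite big1_fset ?addr0 // => A' + _; rewrite in_fsetD1 => /andP[neqA _].
rewrite raddf_sum big1_fset // => B' _ _.
by apply: other; rewrite xpair_eqE negb_and neqA.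
Qed.

Lemma mcoeff_outside S x A i : gsupported S x -> i \in A -> ~~ S i -> x@_A = 0.
Proof. by move=> Sx iA; apply: contraNeq => /Sx/(_ i iA). Qed.

Lemma gsupported_prod_block m n (g : 'I_n -> G) :
    (forall i : 'I_n, gsupported (fun k => m * i <= k < m * i.+1)%N (g i)) ->
  gsupported (fun k => k < m * n)%N (\prod_(i < n) g i).
Proof.
elim: n g => [|n IHn] g Sg; first by rewrite big_ord0; apply: gsupported1.
rewrite big_ord_recr; apply: gsupportedM.
  apply: gsupported_sub (IHn _ _) => [k ltk|i]; last exact: Sg.
  by apply: leq_trans (ltk : (k < m * n)%N) _; rewrite leq_mul2l leqnSn orbT.
by apply: gsupported_sub (Sg _) => k /andP[].
Qed.

Lemma mcoeff_prod_block m n (g : 'I_n -> G) (A : 'I_n -> {fset nat}) :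
    (forall i : 'I_n, gsupported (fun k => m * i <= k < m * i.+1)%N (g i)) ->
    (forall (i : 'I_n) k, k \in A i -> (m * i <= k < m * i.+1)%N) ->
  (\prod_(i < n) g i)@_(\big[@fsetU _/fset0]_(i < n) A i) =
    \prod_(i < n) (g i)@_(A i).
Proof.
elim: n g A => [|n IHn] g A Sg sA; first by rewrite !big_ord0 mcoeffUU.
rewrite !big_ord_recr /= -IHn => [|i|i k]; [|exact: Sg|exact: sA].
apply: (mcoeffM_lt (S := fun k => (k < m * n)%N)
                   (T := fun k => (m * n <= k < m * n.+1)%N)).
- by move=> i j ltim /andP[+ _]; apply: leq_trans ltim.
- by apply: gsupported_prod_block => i; apply: Sg.
- exact: Sg.
- move=> k; have: (k \in \big[@fsetU _/fset0]_(i < n) A (widen_ord (leqnSn n) i)) ->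
    exists i : 'I_n, k \in A (widen_ord (leqnSn n) i).
    elim/big_rec: _ => [|i B _ IH]; first by rewrite in_fset0.
    by case/fsetUP => [kA|/IH //]; exists i.
  move=> exA /exA[i /sA/andP[_ ltk]].
  exact: leq_trans ltk (leq_mul (leqnn m) (ltn_ord i)).
- exact: sA.
Qed.

(** The product e_k e_(k+1): even, of square 0. *)
Definition gpair k : G := << [fset k; k.+1] >>.

Lemma gpair_sqr0 k : gpair k * gpair k = 0.
Proof.
rewrite gmul_def gmulUU /gsgn (_ : [disjoint _ & _] = false) ?mulr0 ?monalgU0 //.
apply/negbTE; rewrite -fsetI_eq0 fsetIid; apply/fset0Pn.
by exists k; rewrite !inE eqxx.
Qed.

Definition iotaf b n : {fset nat} := [fset i in iota b n].

Lemma in_iotaf b n i : (i \in iotaf b n) = (b <= i < b + n)%N.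
Proof. by rewrite inE mem_iota. Qed.

(** The value given to an even variable: the scalar c plus r products of two
    generators, on the indices b, ..., b + 2r - 1. *)
Definition gpairs (c : F) b r : G := c *: (1 : G) + \sum_(k < r) gpair (b + k.*2).

Lemma gpairsS c b r : gpairs c b r.+1 = gpairs c b r + gpair (b + r.*2).
Proof. by rewrite /gpairs big_ord_recr /= addrA. Qed.

Lemma gpairs_supported c b r :
  gsupported (fun i => b <= i < b + r.*2)%N (gpairs c b r).
Proof.
apply: gspanD; first by apply: gspanZ; apply: gsupported1.
apply: gspan_sum => k _; apply: gspanU => i; rewrite !inE.
have := ltn_ord k; rewrite -leq_double doubleS => ltk.
case/orP => /eqP->; rewrite -topredE /=.
  by rewrite leq_addr ltn_add2l ltnW.
by rewrite -addnS leq_addr ltn_add2l.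
Qed.

Lemma gpair_even k : ghomog false (gpair k).
Proof. by apply: gspanU; rewrite cardfs2 neq_ltn ltnSn. Qed.

Lemma gpairs_even c b r : ghomog false (gpairs c b r).
Proof.
apply: gspanD; first by apply: gspanZ; apply: gspanU; rewrite cardfs0.
by apply: gspan_sum => k _; apply: gpair_even.
Qed.

Lemma gpairs_comm c b r k : GRing.comm (gpairs c b r) (gpair k).
Proof. exact: even_comm (@gpairs_even c b r) (@gpair_even k). Qed.

Lemma iotafD b m n : iotaf b (m + n) = iotaf b m `|` iotaf (b + m) n.
Proof. by apply/fsetP => i; rewrite !inE iotaD mem_cat. Qed.

(** The right-hand side is the r-th derivative of X^a at c. Each summand
    [gpair] is a square-zero increment, so extracting its coefficient
    differentiates once. *)
Lemma mcoeff_gpairsX c b r a :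
  (gpairs c b r ^+ a)@_(iotaf b r.*2) = (a ^_ r)%:R * c ^+ (a - r).
Proof.
elim: r a => [|r IHr] a.
  rewrite /gpairs big_ord0 addr0 ffactn0 mul1r subn0.
  rewrite (_ : iotaf b 0 = fset0); last first.
    by apply/fsetP => i; rewrite in_iotaf addn0 inE; case: ltngtP.
  by rewrite exprZn expr1n mcoeffZ mcoeffUU mulr1.
rewrite gpairsS (exprD_sqr0 _ (@gpairs_comm c b r _) (gpair_sqr0 _)).
rewrite doubleS -addn2 iotafD mcoeffD mcoeffMn.
have sX k := gsupportedX (n := k) (@gpairs_supported c b r).
(* The term without the new pair does not contribute: its index b + 2r is absent. *)
rewrite (mcoeff_outside (sX a) (i := b + r.*2)%N) ?add0r; last 2 first.
- by rewrite in_fsetU [X in _ || X]in_iotaf leqnn -addn1 leq_add2l orbT.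
- by rewrite ltnn andbF.
rewrite (@mcoeffM_lt (fun i => b <= i < b + r.*2)%N (fun i => b + r.*2 <= i)%N);
  first 1 last.
- by move=> i j /andP[_ lti]; apply: leq_trans.
- exact: sX.
- by apply: gspanU => i; rewrite !inE => /orP[]/eqP->; rewrite -topredE /=.
- by move=> i; rewrite in_iotaf.
- by move=> i; rewrite in_iotaf => /andP[].
rewrite IHr (_ : iotaf _ 2 = [fset (b + r.*2)%N; (b + r.*2).+1]); last first.
  by apply/fsetP => i; rewrite /iotaf /= !inE ?orbF.
rewrite mcoeffUU mulr1 -mulrnAl -mulr_natl -natrM.
by case: a => [|a]; rewrite ?mul0r ?mul0n // ffactSS.
Qed.

(** The value given to an odd variable. The value 0 is what allows the words
    without this variable to be tested separately. *)
Definition godd_switch (d : bool) k : G := if d then ggen F k else 0.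

Lemma godd_switch_odd d k : ghomog true (godd_switch d k).
Proof.
case: d; last exact: gspan0.
by apply: gspanU; rewrite cardfs1.
Qed.

Lemma mcoeff_block c b r a (d e : bool) :
  (gpairs c b r ^+ a * godd_switch d (b + r.*2) ^+ e)@_(iotaf b (r.*2 + d)) =
  (e == d)%:R * ((a ^_ r)%:R * c ^+ (a - r)).
Proof.
have sX k := gsupportedX (n := k) (@gpairs_supported c b r).
case: d e => [] [] /=; rewrite ?expr1 ?expr0 ?mulr1 ?addn0 ?mul1r ?mul0r.
- rewrite iotafD (@mcoeffM_lt (fun i => b <= i < b + r.*2)%N (fun i => b + r.*2 <= i)%N).
  + rewrite mcoeff_gpairsX (_ : iotaf _ 1 = [fset (b + r.*2)%N]) ?mcoeffUU ?mulr1 //.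
    by apply/fsetP => i; rewrite /iotaf /= !inE ?orbF.
  + by move=> i j /andP[_ lti]; apply: leq_trans.
  + exact: sX.
  + by apply: gspanU => i; rewrite !inE => /eqP->; rewrite -topredE /=.
  + by move=> i; rewrite in_iotaf.
  + by move=> i; rewrite in_iotaf => /andP[].
- rewrite (mcoeff_outside (i := b + r.*2)%N (sX a)) ?ltnn ?andbF //.
  by rewrite in_iotaf leq_addr addnA addn1 ltnSn.
- by rewrite mulr0 mcoeff0.
- exact: mcoeff_gpairsX.
Qed.

Lemma gsupported_block c b r a (d e : bool) :
  gsupported (fun i => b <= i < b + r.*2.+1)%N
    (gpairs c b r ^+ a * godd_switch d (b + r.*2) ^+ e).
Proof.
apply: gsupportedM; apply: gsupportedX.
  apply: gsupported_sub (@gpairs_supported c b r) => i /andP[lei lti].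
  by rewrite -topredE /= lei addnS ltnW.
rewrite /godd_switch; case: d; last exact: gspan0.
by apply: gspanU => i; rewrite !inE => /eqP->; rewrite -topredE /= leq_addr addnS /=.
Qed.

End GrassmannCoefficients.

(** * Evaluation of noncommutative polynomials *)

Lemma malg_scaleU (K : choiceType) (R : nzRingType) (a b : R) (k : K) :
  (a *: (<< b *g k >> : {malg R[K]}) = << a * b *g k >>)%R.
Proof. by apply/malgP => l; rewrite mcoeffZ !mcoeffU mulrnAr. Qed.

Section FreeAlgebra.
Local Open Scope ring_scope.
Variable F : fieldType.

(** A copy of the free algebra that records that scalars are central, so that
    [geval] also describes substitutions of polynomials for variables. *)
Definition free_alg : Type := freealg F.

HB.instance Definition _ := GRing.Lalgebra.copy free_alg (freealg F).

Lemma free_scaleAr (a : F) (f g : freealg F) : a *: (f * g) = f * (a *: g).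
Proof.
rewrite (malgME f g) (malgMEw (fsubset_refl _) (msuppZ_le a g)).
rewrite scaler_sumr; apply: eq_bigr => m _; rewrite scaler_sumr.
by apply: eq_bigr => n _; rewrite malg_scaleU mcoeffZ mulrCA.
Qed.

HB.instance Definition _ := GRing.Lalgebra_isAlgebra.Build F free_alg free_scaleAr.

Section Evaluation.
Variables (A : algType F) (s : nat + nat -> A).

Definition weval (m : {fmonom (nat + nat)%type}) : A := \prod_(x <- m) s x.

Lemma weval_morphism : mmorphism weval.
Proof. by split=> [m n|]; rewrite /weval ?fm1 ?big_nil // fmM big_cat. Qed.

HB.instance Definition _ := isMultiplicative.Build _ _ weval weval_morphism.

Lemma geval_linear : linear (geval s : freealg F -> A).
Proof.
move=> a f g; rewrite /geval mmapD; congr (_ + _).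
by rewrite (mmapZ (f := in_alg A) (h := weval)) /= mulr_algl.
Qed.

HB.instance Definition _ :=
  GRing.isLinear.Build F (freealg F) A _ (geval s) geval_linear.

Lemma geval_monoid_morphism : monoid_morphism (geval s : freealg F -> A).
Proof.
have [|gM g1] := @commr_mmap_is_multiplicative _ _ _ (in_alg A) weval.
  by move=> g m m'; rewrite /GRing.comm /= mulr_algl mulr_algr.
by split.
Qed.

HB.instance Definition _ :=
  GRing.isMonoidMorphism.Build (freealg F) A (geval s) geval_monoid_morphism.

Implicit Types f g : freealg F.

Lemma gevalD f g : geval s (f + g) = geval s f + geval s g.
Proof. exact: linearD. Qed.

Lemma gevalB f g : geval s (f - g) = geval s f - geval s g.
Proof. exact: linearB. Qed.

Lemma gevalM f g : geval s (f * g) = geval s f * geval s g.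
Proof. exact: rmorphM. Qed.

Lemma geval_lie f g :
  geval s (lie f g) = geval s f * geval s g - geval s g * geval s f.
Proof. by rewrite /lie gevalB; congr (_ - _); apply: gevalM. Qed.

Lemma geval_anticomm f g :
  geval s (f * g + g * f) = geval s f * geval s g + geval s g * geval s f.
Proof. by rewrite gevalD; congr (_ + _); apply: gevalM. Qed.

Lemma gevalX f n : geval s (f ^+ n) = geval s f ^+ n.
Proof. exact: rmorphXn. Qed.

Lemma gevalU a m : geval s (<< a *g m >> : freealg F) = a *: weval m.
Proof. by rewrite /geval mmapU /= mulr_algl. Qed.

Lemma geval_var x : geval s (<< fmu x >> : freealg F) = s x.
Proof. by rewrite gevalU scale1r /weval fmU big_seq1. Qed.

End Evaluation.

Lemma free_monE (m : {fmonom (nat + nat)%type}) :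
  (<< m >> : freealg F) = \prod_(x <- m) << fmu x >>.
Proof.
case: m; elim=> [|x w IHw]; first by rewrite big_nil -fmoneE.
rewrite big_cons -IHw; apply/esym.
have -> : FMonom (x :: w) = mmul (fmu x) (FMonom w).
  by apply/eqP; rewrite fmP fmM fmU.
by rewrite malgM_def fgmulUU mulr1.
Qed.

Lemma free_expand (f : freealg F) : f = \sum_(m <- msupp f) f@_m *: << m >>.
Proof.
rewrite {1}[f]monalgE; apply: eq_bigr => m _.
by rewrite malg_scaleU mulr1.
Qed.

(** The universal property of the free algebra. *)
Lemma lrmorph_geval (A : algType F) (phi : {lrmorphism freealg F -> A}) f :
  phi f = geval (fun x => phi << fmu x >>) f.
Proof.
rewrite [f]free_expand !linear_sum; apply: eq_bigr => m _.
by rewrite !linearZ /= gevalU scale1r free_monE rmorph_prod.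
Qed.

Lemma geval_lrmorph (A : algType F) (s : nat + nat -> A)
    (phi : {lrmorphism freealg F -> freealg F}) f :
  geval s (phi f) = geval (fun x => geval s (phi << fmu x >>)) f.
Proof. exact: (lrmorph_geval (geval s \o phi)). Qed.

End FreeAlgebra.

(** * The graded identities of the Grassmann algebra form a T2-ideal *)

Section GrassmannIdentities.
Local Open Scope ring_scope.
Variable F : finFieldType.
Local Notation G := (grassmann F).
Hypothesis F2 : (2%:R : F) != 0.

Definition graded_subst (s : nat + nat -> G) := forall x, ghomog (is_z x) (s x).

Lemma T2_GrassmannP (f : freealg F) :
  T2 (even_part (@phi0 F)) (odd_part (@phi0 F)) f <->
  forall s, graded_subst s -> geval s f = 0.
Proof.
split=> [T2f s hs|hf s hs0 hs1].
  apply: T2f => i; first exact/(even_partE F2)/(hs (inl i)).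
  exact/(odd_partE F2)/(hs (inr i)).
by apply: hf => -[] i; [exact/(even_partE F2)|exact/(odd_partE F2)].
Qed.

Lemma geval_homog s d (f : freealg F) :
  graded_subst s -> free_homog d f -> ghomog d (geval s f).
Proof.
move=> hs hf; rewrite [f]free_expand linear_sum big_seq.
apply: gspan_sum => m /hf <-; rewrite linearZ /= gevalU scale1r; apply: gspanZ.
rewrite /weval; elim: (fmonom_val m) => [|x w IHw].
  by rewrite big_nil; apply: gspanU; rewrite cardfs0.
by rewrite big_cons /= oddD oddb; apply: ghomogM.
Qed.

Lemma var_homog x : free_homog (is_z x) (<< fmu x >> : freealg F).
Proof.
by move=> m; rewrite msuppU1 inE => /eqP->; rewrite fmU /= addn0 oddb.
Qed.

Lemma T2_Grassmann_T2_ideal :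
  T2_ideal (T2 (even_part (@phi0 F)) (odd_part (@phi0 F))).
Proof.
split; [split|].
- by apply/T2_GrassmannP => s _; rewrite linear0.
- move=> f g /T2_GrassmannP Tf /T2_GrassmannP Tg; apply/T2_GrassmannP => s hs.
  by rewrite gevalD Tf // Tg // addr0.
- move=> f g /T2_GrassmannP Tf.
  by split; apply/T2_GrassmannP => s hs; rewrite gevalM Tf // ?mulr0 ?mul0r.
move=> phi hphi f /T2_GrassmannP Tf; apply/T2_GrassmannP => s hs.
rewrite geval_lrmorph Tf // => x.
exact/geval_homog/hphi/var_homog.
Qed.

Lemma T2_Grassmann_gens (p : nat) f : p \in [pchar F] ->
  I1_gens p #|F| f -> T2 (even_part (@phi0 F)) (odd_part (@phi0 F)) f.
Proof.
move=> pcharFp gen; apply/T2_GrassmannP => s hs.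
have pq_exp (x : G) : ghomog false x -> x ^+ (p * #|F|) = x ^+ p.
  by move=> hx; rewrite exprM (even_exp_pchar pcharFp hx) exprZn expr1n expf_card.
have ey i : geval s (yvar F i) = s (inl i) := geval_var s _.
have ez i : geval s (zvar F i) = s (inr i) := geval_var s _.
case: gen => ->.
- rewrite geval_lie !ey (even_comm (hs (inl 0%N)) (hs (inl 1%N))).
  exact: subrr.
- rewrite geval_lie ey ez (even_comm (hs (inl 0%N)) (hs (inr 1%N))).
  exact: subrr.
- rewrite geval_anticomm !ez (ghomogM_comm (hs (inr 0%N)) (hs (inr 1%N))).
  by rewrite scaleN1r addNr.
- rewrite gevalB 2!gevalX ey (pq_exp _ (hs (inl 0%N))).
  exact: subrr.
Qed.

Lemma I1_sub_T2_Grassmann (p : nat) f : p \in [pchar F] ->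
  I1 p #|F| f -> T2 (even_part (@phi0 F)) (odd_part (@phi0 F)) f.
Proof.
move=> pcharFp; apply=> [|g]; first exact: T2_Grassmann_T2_ideal.
exact: T2_Grassmann_gens.
Qed.

End GrassmannIdentities.

(** * Normal forms modulo the generators *)

Section NormalForm.
Local Open Scope ring_scope.
Variables (F : fieldType) (R : algType F) (I : R -> Prop).
Variables (y z : nat -> R) (p N n : nat).

Hypothesis F2 : (2%:R : F) != 0.
Hypothesis lt_pN : (p < N)%N.
Hypothesis I0 : I 0.
Hypothesis ID : forall f g, I f -> I g -> I (f + g).
Hypothesis IMl : forall f g, I f -> I (g * f).
Hypothesis IMr : forall f g, I f -> I (f * g).
Hypothesis Iyy : forall i j, I (y i * y j - y j * y i).
Hypothesis Iyz : forall i j, I (y i * z j - z j * y i).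
Hypothesis Izz : forall i j, I (z i * z j + z j * z i).
Hypothesis IyX : forall i, I (y i ^+ N - y i ^+ p).

Definition eqI f g := I (f - g).

Lemma IZ a f : I f -> I (a *: f).
Proof. by move=> If; rewrite -[f]mul1r scalerAl; apply: IMl. Qed.

Lemma eqI_refl f : eqI f f.
Proof. by rewrite /eqI subrr. Qed.

Lemma eqI_trans g f h : eqI f g -> eqI g h -> eqI f h.
Proof. by move=> fg gh; rewrite /eqI -[f](subrK g) -addrA; apply: ID. Qed.

Lemma eqI_sym f g : eqI f g -> eqI g f.
Proof. by move=> fg; rewrite /eqI -opprB -[- (f - g)]scaleN1r; apply: IZ. Qed.

Lemma eqI_mull h f g : eqI f g -> eqI (h * f) (h * g).
Proof. by rewrite /eqI -mulrBr; apply: IMl. Qed.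

Lemma eqI_mulr h f g : eqI f g -> eqI (f * h) (g * h).
Proof. by rewrite /eqI -mulrBl; apply: IMr. Qed.

Lemma eqI_scale a f g : eqI f g -> eqI (a *: f) (a *: g).
Proof. by rewrite /eqI -scalerBr; apply: IZ. Qed.

Lemma eqI_add f g f' g' : eqI f g -> eqI f' g' -> eqI (f + f') (g + g').
Proof. by rewrite /eqI opprD addrACA; apply: ID. Qed.

(** Commutation up to a scalar modulo I, the common form of the relations between
    the letters y and z. *)
Definition scomm f g := exists a : F, eqI (f * g) (a *: (g * f)).

Lemma scomm1 g : scomm 1 g.
Proof. by exists 1; rewrite mul1r mulr1 scale1r; apply: eqI_refl. Qed.

Lemma scommM f f' g : scomm f g -> scomm f' g -> scomm (f * f') g.
Proof.
move=> [a fg] [a' f'g]; exists (a' * a).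
rewrite -mulrA; apply: eqI_trans (eqI_mull f f'g) _.
rewrite -scalerAr -scalerA mulrA; apply: eqI_scale.
by rewrite mulrA scalerAl; apply: eqI_mulr.
Qed.

Lemma scommX k f g : scomm f g -> scomm (f ^+ k) g.
Proof.
move=> fg; elim: k => [|k IHk]; first exact: scomm1.
by rewrite exprS; apply: scommM.
Qed.

Lemma scomm_prod J (r : seq J) (b : J -> R) g :
  (forall i, scomm (b i) g) -> scomm (\prod_(i <- r) b i) g.
Proof.
move=> bg; apply: (big_ind (scomm^~ g)) => //; first exact: scomm1.
by move=> f f'; apply: scommM.
Qed.

(** The letter x is moved to the left through the factors that follow b j and is
    then absorbed by b j. *)
Lemma prod_absorb (J : eqType) (r : seq J) (b b' : J -> R) j x a :
    uniq r -> j \in r -> (forall i, scomm (b i) x) ->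
    eqI (b j * x) (a *: b' j) -> (forall i, i != j -> b' i = b i) ->
  exists a', eqI ((\prod_(i <- r) b i) * x) (a' *: \prod_(i <- r) b' i).
Proof.
move=> + + bx bj bb'; elim: r => //= i r IHr /andP[ir uniqr].
rewrite inE eq_sym !big_cons -mulrA; case: eqP => [eq_ij _|/eqP neq_ij /= jr].
  have [c Px] := scomm_prod r bx; exists (c * a); rewrite -scalerA.
  apply: eqI_trans (eqI_mull _ Px) _; rewrite -scalerAr; apply: eqI_scale.
  rewrite mulrA scalerAl eq_ij.
  rewrite [X in eqI _ (_ * X)](_ : _ = \prod_(k <- r) b k); first exact: eqI_mulr.
  apply: eq_big_seq => k kr; apply: bb'; apply: contraNneq ir => kj.
  by rewrite eq_ij -kj.
have [c Px] := IHr uniqr jr; exists c.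
apply: eqI_trans (eqI_mull _ Px) _.
by rewrite -scalerAr bb' //; apply: eqI_refl.
Qed.

Definition letter (x : nat + nat) : R :=
  match x with inl i => y i | inr i => z i end.

Definition letter_index (x : nat + nat) : nat := match x with inl i | inr i => i end.

Lemma letter_scomm x x' : scomm (letter x) (letter x').
Proof.
have sub a f g : I (f * g - a *: (g * f)) -> scomm f g by exists a.
case: x x' => [i|i] [j|j] /=.
- by apply: (sub 1); rewrite scale1r.
- by apply: (sub 1); rewrite scale1r.
- by apply: (sub 1); rewrite scale1r; apply: eqI_sym.
- by apply: (sub (-1)); rewrite scaleN1r opprK.
Qed.

Lemma sqr_z i : I (z i * z i).
Proof.
rewrite -[z i * z i]scale1r -(mulVf F2) -scalerA scaler_nat mulr2n.
exact/IZ/Izz.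
Qed.

Definition nblock i (u : 'I_N * bool) : R := y i ^+ u.1 * z i ^+ u.2.

Definition nword (u : {ffun 'I_n -> 'I_N * bool}) : R :=
  \prod_(i < n) nblock i (u i).

Lemma nblock_scomm i u x : scomm (nblock i u) (letter x).
Proof.
apply: scommM; apply: scommX; first exact: (letter_scomm (inl i)).
exact: (letter_scomm (inr i)).
Qed.

(** For a letter y the exponent wraps from N back to p; for a letter z the block
    vanishes modulo I when z is already there. *)
Lemma nblock_mul (u : 'I_N * bool) x : exists a u',
  eqI (nblock (letter_index x) u * letter x) (a *: nblock (letter_index x) u').
Proof.
case: u x => a e [i|i] /=.
  have [c zy] : scomm (z i ^+ e) (y i).
    exact/scommX/(letter_scomm (inr i) (inl i)).
  have step : eqI (y i ^+ a * z i ^+ e * y i) (c *: (y i ^+ a.+1 * z i ^+ e)).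
    rewrite -mulrA; apply: eqI_trans (eqI_mull _ zy) _.
    by rewrite -scalerAr mulrA -exprSr; apply: eqI_refl.
  have [ltaN|leNa] := ltnP a.+1 N.
    by exists c, (Ordinal ltaN, e).
  exists c, (Ordinal lt_pN, e); apply: eqI_trans step _.
  apply/eqI_scale/eqI_mulr; rewrite (_ : a.+1 = N); first exact: IyX.
  by apply/eqP; rewrite eqn_leq leNa ltn_ord.
case: e; last first.
  by exists 1, (a, true); rewrite scale1r /nblock /= mulr1; apply: eqI_refl.
exists 0, (a, true); rewrite /eqI scale0r subr0 /nblock /= -mulrA.
by apply/IMl/sqr_z.
Qed.

Lemma nword_mul u x : (letter_index x < n)%N -> exists a u',
  eqI (nword u * letter x) (a *: nword u').
Proof.
move=> ltxn; set j := Ordinal ltxn.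
have [a [v uv]] := nblock_mul (u j) x.
pose u' := [ffun i => if i == j then v else u i].
have [|||||a' E] := @prod_absorb _ (index_enum 'I_n)
    (fun i : 'I_n => nblock i (u i)) (fun i : 'I_n => nblock i (u' i)) j (letter x) a.
- exact: index_enum_uniq.
- exact: mem_index_enum.
- by move=> i; apply: nblock_scomm.
- by rewrite ffunE eqxx.
- by move=> i /negPf neq_ij; rewrite ffunE neq_ij.
by exists a', u'.
Qed.

Definition nreducible f :=
  exists c : {ffun {ffun 'I_n -> 'I_N * bool} -> F}, eqI f (\sum_u c u *: nword u).

Lemma nreducible_eqI f g : eqI f g -> nreducible g -> nreducible f.
Proof. by move=> fg [c gc]; exists c; apply: eqI_trans gc. Qed.

Lemma nreducible0 : nreducible 0.
Proof.
exists [ffun=> 0]; rewrite big1 => [|u _]; first exact: eqI_refl.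
by rewrite ffunE scale0r.
Qed.

Lemma nreducibleD f g : nreducible f -> nreducible g -> nreducible (f + g).
Proof.
move=> [c fc] [c' gc]; exists [ffun u => c u + c' u].
under eq_bigr do rewrite ffunE scalerDl.
by rewrite big_split; apply: eqI_add.
Qed.

Lemma nreducibleZ a f : nreducible f -> nreducible (a *: f).
Proof.
move=> [c fc]; exists [ffun u => a * c u].
under eq_bigr do rewrite ffunE -scalerA.
by rewrite -scaler_sumr; apply: eqI_scale.
Qed.

Lemma nreducible_sum J (r : seq J) (P : pred J) (f : J -> R) :
  (forall i, P i -> nreducible (f i)) -> nreducible (\sum_(i <- r | P i) f i).
Proof.
move=> rf; apply: (big_ind nreducible) => //; first exact: nreducible0.
exact: nreducibleD.
Qed.

Lemma nreducible_nword u : nreducible (nword u).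
Proof.
exists [ffun v => (v == u)%:R]; rewrite (bigD1 u) //= big1 ?addr0 => [|v /negPf neq_vu].
  by rewrite ffunE eqxx scale1r; apply: eqI_refl.
by rewrite ffunE neq_vu scale0r.
Qed.

Lemma nreducible_mul f x : (letter_index x < n)%N ->
  nreducible f -> nreducible (f * letter x).
Proof.
move=> ltxn [c fc]; apply: nreducible_eqI (eqI_mulr _ fc) _.
rewrite mulr_suml; apply: nreducible_sum => u _; rewrite -scalerAl; apply: nreducibleZ.
have [a [v uv]] := nword_mul u ltxn; apply: nreducible_eqI uv _.
exact/nreducibleZ/nreducible_nword.
Qed.

Lemma nreducible_word (w : seq (nat + nat)) :
  all (fun x => letter_index x < n)%N w -> nreducible (\prod_(x <- w) letter x).
Proof.
elim/last_ind: w => [_|w x IHw].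
  rewrite big_nil; have N_gt0 := leq_ltn_trans (leq0n p) lt_pN.
  rewrite (_ : 1 = nword [ffun=> (Ordinal N_gt0, false)]).
    exact: nreducible_nword.
  by rewrite /nword big1 // => i _; rewrite ffunE /nblock mulr1.
by rewrite all_rcons big_rcons => /andP[ltxn /IHw]; apply: nreducible_mul.
Qed.

End NormalForm.

Section Reduction.
Local Open Scope ring_scope.
Variable F : fieldType.
Implicit Types f g : freealg F.

Lemma T2_generated_gen (S : freealg F -> Prop) f : S f -> T2_generated S f.
Proof. by move=> Sf I _; apply. Qed.

Lemma T2_generated_T2_ideal (S : freealg F -> Prop) : T2_ideal (T2_generated S).
Proof.
split; [split|].
- by move=> I [[]].
- move=> f g Sf Sg I TI SI; case: (TI) => -[_ ID _] _.
  by apply: ID; [apply: Sf|apply: Sg].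
- move=> f g Sf; split=> I TI SI; case: (TI) => -[_ _ IM] _;
  by case: (IM f g (Sf I TI SI)).
- by move=> phi hphi f Sf I TI SI; case: (TI) => _; apply=> //; apply: Sf.
Qed.

Section Substitution.
Variable r : nat + nat -> nat + nat.

(** The renamings are the graded endomorphisms that carry the relations between
    the first variables to all variables. *)
Definition free_rename : freealg F -> freealg F :=
  geval (fun x => << fmu (r x) >> : free_alg F).

Lemma free_rename_linear : linear free_rename.
Proof. by move=> a f g; apply: (@geval_linear F (free_alg F)). Qed.

HB.instance Definition _ :=
  GRing.isLinear.Build F (freealg F) (freealg F) _ free_rename free_rename_linear.

Lemma free_rename_monoid_morphism : monoid_morphism free_rename.
Proof. exact: (@geval_monoid_morphism F (free_alg F)). Qed.

HB.instance Definition _ :=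
  GRing.isMonoidMorphism.Build (freealg F) (freealg F) free_rename
    free_rename_monoid_morphism.

Lemma free_rename_mon (m : {fmonom (nat + nat)%type}) :
  free_rename << m >> = << FMonom (map r m) >>.
Proof.
rewrite /free_rename gevalU scale1r /weval [RHS]free_monE.
by rewrite [fmonom_val (FMonom _)]/= big_map.
Qed.

Lemma free_rename_graded : (forall x, is_z (r x) = is_z x) ->
  graded_endo (free_rename : {lrmorphism freealg F -> freealg F}).
Proof.
move=> zr d f hf m; rewrite -mcoeff_neq0 /=.
have -> : free_rename f = \sum_(k <- msupp f) f@_k *: << FMonom (map r k) >>.
  rewrite {1}[f]free_expand linear_sum /=; apply: eq_bigr => k _.
  by rewrite linearZ /= free_rename_mon.
rewrite (raddf_sum (mcoeff m)) /= => mf.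
have [k kf fk] : exists2 k, k \in msupp f & FMonom (map r k) == m.
  apply/hasP; apply: contraNT mf => /hasPn nf; rewrite big_seq big1 // => k kf.
  by rewrite malg_scaleU mcoeffU (negPf (nf k kf)).
rewrite -(eqP fk) /= count_map -(hf k kf).
by congr odd; apply: eq_count => x; apply: zr.
Qed.

Lemma free_rename_lie f g :
  free_rename (lie f g) = lie (free_rename f) (free_rename g).
Proof. by rewrite /lie rmorphB; congr (_ - _); apply: rmorphM. Qed.

Lemma free_rename_anticomm f g : free_rename (f * g + g * f) =
  free_rename f * free_rename g + free_rename g * free_rename f.
Proof. by rewrite rmorphD; congr (_ + _); apply: rmorphM. Qed.

Lemma free_rename_subX f m n :
  free_rename (f ^+ m - f ^+ n) = free_rename f ^+ m - free_rename f ^+ n.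
Proof. by rewrite rmorphB; congr (_ - _); apply: rmorphXn. Qed.

End Substitution.

Section Relations.
Variables (p q : nat).
Local Notation I := (I1 (F := F) p q).

Definition rename2 (a b : nat -> nat) (x : nat + nat) : nat + nat :=
  match x with inl i => inl (a i) | inr i => inr (b i) end.

Lemma I1_rename a b f : I f -> I (free_rename (rename2 a b) f).
Proof.
move=> If; have [_] := T2_generated_T2_ideal (I1_gens (F := F) p q).
move/(_ (free_rename (rename2 a b))); apply=> //.
by apply: free_rename_graded => -[].
Qed.

Lemma rename_yvar a b i : free_rename (rename2 a b) (yvar F i) = yvar F (a i).
Proof. exact: (@geval_var F (free_alg F) _ (inl i)). Qed.

Lemma rename_zvar a b i : free_rename (rename2 a b) (zvar F i) = zvar F (b i).
Proof. exact: (@geval_var F (free_alg F) _ (inr i)). Qed.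

Let pick2 i j k : nat := if k is 0 then i else j.

Lemma I1_yy i j : I (lie (yvar F i) (yvar F j)).
Proof.
rewrite -[yvar F i](rename_yvar (pick2 i j) id 0).
rewrite -[yvar F j](rename_yvar (pick2 i j) id 1) -free_rename_lie.
by apply: I1_rename; apply: T2_generated_gen; constructor 1.
Qed.

Lemma I1_yz i j : I (lie (yvar F i) (zvar F j)).
Proof.
rewrite -[yvar F i](rename_yvar (fun=> i) (fun=> j) 0).
rewrite -[zvar F j](rename_zvar (fun=> i) (fun=> j) 1) -free_rename_lie.
by apply: I1_rename; apply: T2_generated_gen; constructor 2.
Qed.

Lemma I1_zz i j : I (zvar F i * zvar F j + zvar F j * zvar F i).
Proof.
rewrite -[zvar F i](rename_zvar id (pick2 i j) 0).
rewrite -[zvar F j](rename_zvar id (pick2 i j) 1) -free_rename_anticomm.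
by apply: I1_rename; apply: T2_generated_gen; constructor 3.
Qed.

Lemma I1_yX i : I (yvar F i ^+ (p * q) - yvar F i ^+ p).
Proof.
rewrite -(rename_yvar (fun=> i) id 0) -free_rename_subX.
by apply: I1_rename; apply: T2_generated_gen; constructor 4.
Qed.

End Relations.

Lemma I1_nreducible p q f : (2%:R : F) != 0 -> (p < p * q)%N ->
  exists n (c : {ffun {ffun 'I_n -> 'I_(p * q) * bool} -> F}),
  I1 p q (f - \sum_u c u *: nword (R := free_alg F) (yvar F) (zvar F) u).
Proof.
move=> F2 lt_pN; have [[I0 ID IM] _] := T2_generated_T2_ideal (I1_gens (F := F) p q).
pose n := (\max_(m <- msupp f) \max_(x <- m) (letter_index x).+1)%N; exists n.
pose J : free_alg F -> Prop := I1 p q.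
have J0 : J 0 by exact: I0.
have JD (g h : free_alg F) : J g -> J h -> J (g + h) by exact: ID.
have JMl (g h : free_alg F) : J g -> J (h * g) by move=> Jg; exact: (IM g h Jg).1.
have JMr (g h : free_alg F) : J g -> J (g * h) by move=> Jg; exact: (IM g h Jg).2.
pose Y i : free_alg F := yvar F i; pose Z i : free_alg F := zvar F i.
have Jyy i j : J (Y i * Y j - Y j * Y i) by exact: I1_yy.
have Jyz i j : J (Y i * Z j - Z j * Y i) by exact: I1_yz.
have Jzz i j : J (Z i * Z j + Z j * Z i) by exact: I1_zz.
have JyX i : J (Y i ^+ (p * q) - Y i ^+ p) by exact: I1_yX.
have -> : f = \sum_(m <- msupp f | m \in msupp f) f@_m *: \prod_(x <- m) letter Y Z x.
  rewrite -big_seq; apply: etrans (free_expand f) _; apply: eq_bigr => m _.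
  by rewrite free_monE; congr (_ *: _); apply: eq_bigr => -[] x.
suff : nreducible J Y Z (p * q) n
  (\sum_(m <- msupp f | m \in msupp f) f@_m *: \prod_(x <- m) letter Y Z x) by [].
apply: (nreducible_sum (I := J) J0 JD) => m mf; apply: (nreducibleZ (I := J) JMl).
apply: (nreducible_word F2 lt_pN J0 JD JMl JMr Jyy Jyz Jzz JyX).
apply/allP => x xm.
have lt_m := @leq_bigmax_seq _ m xpredT (fun x => (letter_index x).+1)%N x xm isT.
apply: (leq_trans lt_m).
exact: (@leq_bigmax_seq _ _ xpredT
  (fun m : {fmonom (nat + nat)%type} => \max_(x <- m) (letter_index x).+1)%N
  m mf isT).
Qed.

End Reduction.

(** * Independence of normal words on the Grassmann algebra *)

Lemma geval_nword (F : fieldType) (A : algType F) (s : nat + nat -> A) (N n : nat)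
    (u : {ffun 'I_n -> 'I_N * bool}) :
  (geval s (nword (R := free_alg F) (yvar F) (zvar F) u) =
    \prod_(i < n) (s (inl (nat_of_ord i)) ^+ (u i).1 *
                     s (inr (nat_of_ord i)) ^+ (u i).2))%R.
Proof.
rewrite /nword; apply: etrans (rmorph_prod (geval s) _ _ _) _; apply: eq_bigr => i _.
apply: etrans (gevalM s (yvar F i ^+ _) (zvar F i ^+ _)) _; congr (_ * _)%R.
  apply: etrans (gevalX s (yvar F i) _) _; congr (_ ^+ _)%R.
  exact: (geval_var s (inl (nat_of_ord i))).
apply: etrans (gevalX s (zvar F i) _) _; congr (_ ^+ _)%R.
exact: (geval_var s (inr (nat_of_ord i))).
Qed.

Lemma geval_sum (F : fieldType) (A : algType F) (s : nat + nat -> A) (J : finType)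
    (c : J -> F) (w : J -> free_alg F) :
  (geval s (\sum_u c u *: w u) = \sum_u c u *: geval s (w u))%R.
Proof.
apply: etrans (linear_sum (geval s) _ _ _) _; apply: eq_bigr => u _.
exact: (linearZ_LR (geval s)).
Qed.

Section Independence.
Local Open Scope fset_scope.
Local Open Scope ring_scope.
Variables (F : finFieldType) (p n : nat).
Local Notation G := (grassmann F).
Local Notation N := (p * #|F|)%N.
Hypothesis pcharFp : p \in [pchar F].
Hypothesis F2 : (2%:R : F) != 0.

Local Notation probe := ('I_p * F * bool)%type.
Implicit Types (t : {ffun 'I_n -> probe}) (u : {ffun 'I_n -> 'I_N * bool}).

(** A probe (r, c, d) at i chooses the order r of differentiation and the point c
    for y_i, and whether z_i is switched on. The i-th interval of length 2p
    contains the at most 2(p-1) + 1 generators that are needed. *)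
Definition probe_subst t (x : nat + nat) : G :=
  match x with
  | inl i => oapp (fun j : 'I_n =>
      gpairs (t j).1.2 (p.*2 * j) (t j).1.1) 0 (insub i)
  | inr i => oapp (fun j : 'I_n =>
      godd_switch F (t j).2 (p.*2 * j + (t j).1.1.*2)) 0 (insub i)
  end.

Lemma probe_subst_graded t : graded_subst (probe_subst t).
Proof.
by case=> i /=; case: insub => [j|] /=;
  [exact: gpairs_even|exact: gspan0|exact: godd_switch_odd|exact: gspan0].
Qed.

Definition probe_block t (i : 'I_n) : {fset nat} :=
  iotaf (p.*2 * i) ((t i).1.1.*2 + (t i).2).

Definition probe_set t := \big[@fsetU _/fset0]_(i < n) probe_block t i.

Definition probe_coef (a : 'I_N * bool) (s : probe) : F :=
  (a.2 == s.2)%:R * ((a.1 ^_ s.1.1)%:R * s.1.2 ^+ (a.1 - s.1.1)).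

(** The interval structure makes the coefficient split into one factor for each
    index, computed by [mcoeff_block]. *)
Lemma mcoeff_probe t u :
  (geval (probe_subst t) (nword (R := free_alg F) (yvar F) (zvar F) u))@_(probe_set t)
  = \prod_i probe_coef (u i) (t i).
Proof.
pose g (i : 'I_n) := gpairs (t i).1.2 (p.*2 * i) (t i).1.1 ^+ (u i).1 *
  godd_switch F (t i).2 (p.*2 * i + (t i).1.1.*2) ^+ (u i).2.
have -> : geval (probe_subst t) (nword (R := free_alg F) (yvar F) (zvar F) u) =
    \prod_(i < n) g i.
  by rewrite geval_nword; apply: eq_bigr => i _; rewrite /= valK.
have lt_t i : ((t i).1.1.*2 < p.*2)%N by rewrite ltn_double.
have sub_block (i : 'I_n) k : (p.*2 * i <= k < p.*2 * i + (t i).1.1.*2.+1)%N ->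
    (p.*2 * i <= k < p.*2 * i.+1)%N.
  case/andP=> -> ltk /=; apply: leq_trans ltk _.
  by rewrite mulnS addnC leq_add2r.
rewrite (mcoeff_prod_block (m := p.*2)) => [|i|i k].
- by apply: eq_bigr => i _; rewrite mcoeff_block.
- apply: gsupported_sub (@gsupported_block _ _ _ _ _ _ _) => k; exact: sub_block.
rewrite in_iotaf => /andP[lek ltk]; apply: sub_block; rewrite lek /=.
apply: leq_trans ltk _; rewrite leq_add2l.
by case: (t i).2; rewrite ?addn1 ?addn0.
Qed.

Lemma nword_independent (c : {ffun 'I_n -> 'I_N * bool} -> F) :
    T2 (even_part (@phi0 F)) (odd_part (@phi0 F))
      (\sum_u c u *: nword (R := free_alg F) (yvar F) (zvar F) u) ->
  forall u, c u = 0.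
Proof.
move=> T2c; have [D MD] := hermite_dual_basis pcharFp.
pose D' (s : probe) (a : 'I_N * bool) : F := (a.2 == s.2)%:R * D s.1 a.1.
apply: (tensor_dual_basis (K := probe_coef) (D := D')) => [a b|t].
  rewrite -(pair_bigA _ (fun s e => probe_coef a (s, e) * D' (s, e) b)) /=.
  under eq_bigr => s _.
    rewrite (_ : \sum_e _ = (a.2 == b.2)%:R *
        ((a.1 ^_ s.1)%:R * s.2 ^+ (a.1 - s.1) * D s b.1)); last first.
      rewrite big_bool /probe_coef /D' /=.
      by case: a.2 b.2 => [] [] /=; rewrite ?(mul0r, mul1r, mulr0, addr0, add0r).
    over.
  by rewrite -mulr_sumr MD -natrM mulnb andbC; case: a b => a1 a2 [b1 b2].
have /(T2_GrassmannP F2)/(_ _ (@probe_subst_graded t)) := T2c.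
rewrite geval_sum => /(congr1 (mcoeff (probe_set t))).
rewrite mcoeff0 (raddf_sum (mcoeff (probe_set t))) /= => c0; rewrite -[RHS]c0.
by apply: eq_bigr => u _; rewrite mcoeffZ mcoeff_probe.
Qed.

End Independence.

Theorem theorem3p3 (F : finFieldType) (p q : nat)
    (hq : #|F| = q) (hp : p \in [pchar F]%R) (hp2 : 2 < p) :
  forall f : freealg F,
    T2 (even_part (@phi0 F)) (odd_part (@phi0 F)) f <-> I1 p q f.
Proof.
have F2 : (2%:R : F)%R != 0%R by rewrite -(dvdn_pcharf hp) gtnNdvd.
have lt_pN : (p < p * #|F|)%N.
  rewrite -[X in (X < _)%N]muln1 ltn_pmul2l ?finNzRing_gt1 //.
  by rewrite prime_gt0 ?(pcharf_prime hp).
move=> f; rewrite -hq; split=> [T2f|]; last exact: I1_sub_T2_Grassmann.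
(* Replace f by its normal form: it is again an identity, so it is 0. *)
have [n [c fc]] := I1_nreducible f F2 lt_pN.
have T2g : T2 (even_part (@phi0 F)) (odd_part (@phi0 F))
    (\sum_u c u *: nword (R := free_alg F) (yvar F) (zvar F) u)%R.
  move/(I1_sub_T2_Grassmann F2 hp)/(T2_GrassmannP F2): fc => fc.
  apply/(T2_GrassmannP F2) => s hs; have := fc s hs.
  rewrite gevalB (iffLR (T2_GrassmannP F2 f) T2f s hs) sub0r.
  by move/eqP; rewrite oppr_eq0 => /eqP.
have c0 := nword_independent hp F2 T2g.
by rewrite big1 ?subr0 // in fc => u _; rewrite c0 scale0r.
Qed.
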